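(* Let $A\in\mathbb{R}^{n\times n}$, $B\in\mathbb{R}^{n\times m}$, $C\in\mathbb{R}^{m\times n}$, $D\in\mathbb{R}^{m\times m}$ be such that $\{A,B,C,D\}$ is a minimal (controllable and observable) realization of the $m\times m$ transfer function $Z(s)=C(sI_n-A)^{-1}B+D$ (no stability or passivity of $Z$ is assumed). Assume that $D+D^{\mathsf T}\succ 0$ and that we are given real matrices $U,V\in\mathbb{R}^{n\times\hat n}$, $W\in\mathbb{R}^{m\times\hat n}$, $R\in\mathbb{R}^{\hat n\times\hat n}$ such that $\begin{bmatrix} U \\ V \\ W \end{bmatrix}$ has full column rank $\hat n$ and, identically in $s$, $$\begin{bmatrix} 0 & A-sI_n & B \\ A^{\mathsf T}+sI_n & 0 & C^{\mathsf T} \\ B^{\mathsf T} & C & D^{\mathsf T}+D \end{bmatrix}\begin{bmatrix} U \\ V \\ W \end{bmatrix}=\begin{bmatrix} V \\ -U \\ 0 \end{bmatrix}(R-sI_{\hat n}),$$ where all eigenvalues of $R$ lie in the open right half plane. Then $\hat X:=-U^{\mathsf T}V$ is symmetric. If, moreover, $\hat X$ is invertible, then the transfer function $\hat Z(s)=\hat C(sI_{\hat n}-\hat A)^{-1}\hat B+\hat D$ of the projected model $$\{\hat A,\hat B,\hat C,\hat D\}:=\{(U^{\mathsf T}V)^{-1}U^{\mathsf T}AV,\ (U^{\mathsf T}V)^{-1}U^{\mathsf T}B,\ CV,\ D\}$$ is strictly positive real; and if $\hat X$ is also positive definite, then $\hat Z(s)$ is strictly passive.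
   Context: For a rational $m\times m$ matrix $Z(s)$ with real coefficients put $\Phi(s):=Z^{\mathsf T}(-s)+Z(s)$. $Z(s)$ is called strictly positive real if $\Phi(\imath\omega)\succ0$ for all $\omega\in\mathbb{R}$ (stability is not part of this definition). $Z(s)$, given by a realization $\{A,B,C,D\}$, is called asymptotically stable if all eigenvalues of $A$ lie in the open left half plane. $Z(s)$ is called strictly passive if it is strictly positive real and asymptotically stable; for the projected model the relevant state matrix is $\hat A$. Here $M\succ 0$ means symmetric (Hermitian) positive definite. *)

(* Defs.v *)
(* The real numbers are an arbitrary [K : realType], the complex numbers [K[i]];
   rational functions are formal, i.e. elements of the fraction field of K[s]. *)
From HB Require Import structures.
From mathcomp Require Import all_boot all_order all_algebra.
From mathcomp Require Import complex.
From mathcomp Require Import reals.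

Set Implicit Arguments.
Unset Strict Implicit.
Unset Printing Implicit Defensive.

Import Order.TTheory GRing.Theory Num.Theory.
Local Open Scope ring_scope.
Local Open Scope complex_scope.
Local Open Scope quotient_scope.

Definition ratfun (K : realType) := {fraction {poly K}}.

Definition rconst (K : realType) (c : K) : ratfun K := tofrac c%:P.

Definition rvar (K : realType) : ratfun K := tofrac 'X.

(* The rational function f(-s); by [rflip_frac] below, the choice of the
   representative of the fraction f is irrelevant. *)
Definition rflip (K : realType) (f : ratfun K) : ratfun K :=
  tofrac (\n_(repr f) \Po (- 'X)) / tofrac (\d_(repr f) \Po (- 'X)).

Definition ceval (K : realType) (p : {poly K}) (z : K[i]) : K[i] :=
  (map_poly (real_complex K) p).[z].

(* f has no pole at z, and f(z) = v. *)
Definition has_value (K : realType) (f : ratfun K) (z v : K[i]) : Prop :=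
  exists p q : {poly K},
    [/\ f = tofrac p / tofrac q, ceval q z != 0 & v = ceval p z / ceval q z].

Definition mx_has_value (K : realType) (m : nat) (Z : 'M[ratfun K]_m)
    (z : K[i]) (M : 'M[K[i]]_m) : Prop :=
  forall i j, has_value (Z i j) z (M i j).

Definition sym_posdef (K : realType) (m : nat) (M : 'M[K]_m) : Prop :=
  M \is symmetricmx /\
  forall x : 'cV[K]_m, x != 0 -> 0 < (x^T *m M *m x) 0 0.

(* On [K[i]], [0 < z] means that z is real and positive. *)
Definition herm_posdef (K : realType) (m : nat) (M : 'M[K[i]]_m) : Prop :=
  M \is hermsymmx /\
  forall x : 'cV[K[i]]_m, x != 0 -> 0 < (map_mx Num.conj x^T *m M *m x) 0 0.

Definition transfer (K : realType) (n m : nat) (A : 'M[K]_n) (B : 'M[K]_(n, m))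
    (C : 'M[K]_(m, n)) (D : 'M[K]_m) : 'M[ratfun K]_m :=
  map_mx (@rconst K) C *m invmx ((rvar K)%:M - map_mx (@rconst K) A)
    *m map_mx (@rconst K) B + map_mx (@rconst K) D.

Definition Phi (K : realType) (m : nat) (Z : 'M[ratfun K]_m) : 'M[ratfun K]_m :=
  (map_mx (@rflip K) Z)^T + Z.

(* Phi is formed as a rational matrix before being evaluated: the requirement
   is that Phi, after possible cancellations, has no pole on the imaginary
   axis and is positive definite there. *)
Definition strictly_positive_real (K : realType) (m : nat)
    (Z : 'M[ratfun K]_m) : Prop :=
  forall w : K, exists2 M : 'M[K[i]]_m,
    mx_has_value (Phi Z) (0 +i* w) M & herm_posdef M.

Definition spectrum_in (K : realType) (n : nat) (A : 'M[K]_n)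
    (S : K[i] -> Prop) : Prop :=
  forall z : K[i], eigenvalue (map_mx (real_complex K) A) z -> S z.

Definition asymptotically_stable (K : realType) (n : nat) (A : 'M[K]_n) : Prop :=
  spectrum_in A (fun z => complex.Re z < 0).

Definition strictly_passive (K : realType) (n m : nat) (A : 'M[K]_n)
    (B : 'M[K]_(n, m)) (C : 'M[K]_(m, n)) (D : 'M[K]_m) : Prop :=
  strictly_positive_real (transfer A B C D) /\ asymptotically_stable A.

Definition controllable (K : realType) (n m : nat) (A : 'M[K]_n)
    (B : 'M[K]_(n, m)) : Prop :=
  \rank (\mxrow_(k < n) (A ^+ k *m B)) = n.

Definition observable (K : realType) (n m : nat) (A : 'M[K]_n)
    (C : 'M[K]_(m, n)) : Prop :=
  \rank (\mxcol_(k < n) (C *m A ^+ k)) = n.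

Definition minimal_realization (K : realType) (n m : nat)
    (Z : 'M[ratfun K]_m) (A : 'M[K]_n) (B : 'M[K]_(n, m)) (C : 'M[K]_(m, n))
    (D : 'M[K]_m) : Prop :=
  [/\ Z = transfer A B C D, controllable A B & observable A C].

Definition polymx (K : realType) (m n : nat) (M : 'M[K]_(m, n)) :
  'M[{poly K}]_(m, n) := map_mx polyC M.

(* The indeterminate s is ['X], so that an equation between such matrices is
   an identity in s. *)
Definition pencil (K : realType) (n m : nat) (A : 'M[K]_n) (B : 'M[K]_(n, m))
    (C : 'M[K]_(m, n)) (D : 'M[K]_m) : 'M[{poly K}]_(n + n + m) :=
  let sI : 'M[{poly K}]_n := ('X)%:M in
  col_mx (col_mx
    (row_mx (row_mx 0                   (polymx A - sI)) (polymx B))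
    (row_mx (row_mx (polymx A^T + sI)    0)              (polymx C^T)))
    (row_mx (row_mx (polymx B^T)         (polymx C))     (polymx (D^T + D))).

Lemma rflip_frac (K : realType) (p q : {poly K}) : q != 0 ->
  rflip (tofrac p / tofrac q) =
  tofrac (p \Po (- 'X)) / tofrac (q \Po (- 'X)).
Proof.
move=> q0; rewrite /rflip; set f := tofrac p / tofrac q; set r := repr f.
have s2 : size (- 'X : {poly K}) = 2 by rewrite size_polyN size_polyX.
have nz (u : {poly K}) : u != 0 -> tofrac (u \Po (- 'X)) != 0.
  by move=> u0; rewrite tofrac_eq0 comp_poly2_eq0.
have d0 := denom_ratioP r.
have fE : f = tofrac \n_r / tofrac \d_r.
  have tE (x y : {poly K}) : y != 0 ->
      tofrac x / tofrac y = \pi_({fraction {poly K}}) (Ratio x y).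
    move=> y0; apply: (@mulIf _ (tofrac y)); first by rewrite tofrac_eq0.
    rewrite divfK ?tofrac_eq0 //.
    rewrite !piE; apply/eqP; rewrite FracField.equivf_def /FracField.mulf.
    rewrite !numden_Ratio ?mulf_neq0 ?oner_neq0 // !mulr1.
    by rewrite mul1r.
  by rewrite tE // Ratio_numden reprK.
have : p * \d_r = \n_r * q.
  apply/eqP; rewrite -tofrac_eq !tofracM; apply/eqP.
  have := fE; rewrite /f => /eqP.
  by rewrite eqr_div ?tofrac_eq0 // => /eqP.
move/(congr1 (fun u => tofrac (u \Po (- 'X)))); rewrite /= !comp_polyM !tofracM.
by move=> E; apply/eqP; rewrite eqr_div ?nz // E.
Qed.

Lemma has_value_inj (K : realType) (f : ratfun K) (z v w : K[i]) :
  has_value f z v -> has_value f z w -> v = w.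
Proof.
have nz (q : {poly K}) : ceval q z != 0 -> tofrac q != 0.
  by rewrite tofrac_eq0; apply: contraNneq => ->; rewrite /ceval rmorph0 horner0.
move=> [p [q [-> q0 ->]]] [p' [q' [E q'0 ->]]].
move/eqP: E; rewrite eqr_div ?nz //; rewrite -!tofracM tofrac_eq => /eqP E.
apply/eqP; rewrite eqr_div //; apply/eqP.
by have := congr1 (fun u => ceval u z) E; rewrite /ceval !rmorphM !hornerM.
Qed.

(* Main.v *)
Require Import Defs.
From mathcomp Require Import all_boot all_order all_algebra.
From mathcomp Require Import complex.
From mathcomp Require Import reals.

Set Implicit Arguments.
Unset Strict Implicit.
Unset Printing Implicit Defensive.

Import Order.TTheory GRing.Theory Num.Theory.
Local Open Scope ring_scope.

(* Write S = D + D^T and X = - U^T V.  The constant term of the pencil identity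
   yields a Lyapunov equation for X - X^T with coefficient R, so X is symmetric.
   If X is invertible, the projected model satisfies
     Ah^T X + X Ah = - W^T S W,  Ch = Bh^T X - S W,  Ah + Bh W = R,
   whence Phi factors on the imaginary axis as G^* S G with
   G = 1 - W (s - Ah)^-1 Bh.  If Ah v = z v with z imaginary, the Lyapunov
   equation forces W v = 0, so R v = z v, which is excluded; likewise a kernel
   vector of G(z) would produce an eigenvector of R.  If X > 0, the same
   Lyapunov equation excludes eigenvalues of Ah with positive real part. *)

(** * Eigenvectors and the homogeneous Sylvester equation *)

Lemma nonunitmx_kernel (F : fieldType) n (M : 'M[F]_n) :
  M \notin unitmx -> exists2 v : 'cV[F]_n, v != 0 & M *m v = 0.
Proof.
rewrite -unitmx_tr -row_free_unit -kermx_eq0 => /rowV0Pn[u /sub_kermxP uM u0].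
exists u^T; first by rewrite trmx_eq0.
by apply: trmx_inj; rewrite trmx_mul trmxK uM trmx0.
Qed.

Lemma eigenvalue_unitmx (F : fieldType) n (M : 'M[F]_n) a :
  eigenvalue M a = (a%:M - M \notin unitmx).
Proof.
rewrite /eigenvalue /eigenspace kermx_eq0 row_free_unit -opprB -scaleN1r.
by rewrite unitmxZ ?unitrN1.
Qed.

Lemma col_eigenvalueP (F : fieldType) n (M : 'M[F]_n) a :
  reflect (exists2 v : 'cV[F]_n, v != 0 & M *m v = a *: v) (eigenvalue M a).
Proof.
rewrite eigenvalue_unitmx; apply: (iffP idP) => [/nonunitmx_kernel[v v0 Ev]|].
  exists v => //; apply/esym/eqP; rewrite -subr_eq0 -mul_scalar_mx -mulmxBl.
  by rewrite Ev.
move=> [v v0 Ev]; apply: contraNN v0 => uM; apply/eqP.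
by rewrite -[v](mulKmx uM) mulmxBl mul_scalar_mx Ev subrr mulmx0.
Qed.

(** The equation propagates to [X *m u(A) = u(B) *m X] for every polynomial [u]. For [u] the
    characteristic polynomial of [A], the left side vanishes by Cayley-Hamilton, while [u(B)] is a
    product of factors [B - a] with [a] an eigenvalue of [A], hence invertible. *)
Lemma sylvester_inj (F : closedFieldType) p q (A : 'M[F]_q) (B : 'M[F]_p)
    (X : 'M[F]_(p, q)) :
  (forall a, eigenvalue A a -> ~~ eigenvalue B a) ->
  X *m A = B *m X -> X = 0.
Proof.
(* Empty shapes are set aside, so that [horner_mx] is applied only at positive sizes. *)
case: q => [|q] in A X *; first by move=> _ _; exact: thinmx0.
case: p => [|p] in B X *; first by move=> _ _; exact: flatmx0.
move=> dAB XAB.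
have XE (u : {poly F}) : X *m horner_mx A u = horner_mx B u *m X.
  elim/poly_ind: u => [|u c IH]; first by rewrite !rmorph0 mulmx0 mul0mx.
  rewrite !rmorphD !rmorphM /= !horner_mx_X !horner_mx_C mulmxDr mulmxDl.
  by rewrite -[_ * A]/(_ *m A) -[_ * B]/(_ *m B) mulmxA IH -!mulmxA XAB scalar_mxC.
have uB : horner_mx B (char_poly A) \in unitmx.
  have [r rE] := closed_field_poly_normal (char_poly A).
  move: rE; rewrite (monicP (char_poly_monic A)) scale1r => rE.
  have : all (eigenvalue A) r.
    by apply/allP => a; rewrite eigenvalue_root_char rE root_prod_XsubC.
  rewrite rE; elim: r {rE} => [|a r IH] /=.
    by rewrite big_nil rmorph1 unitmx1.
  move=> /andP[/dAB Ba /IH ur].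
  rewrite big_cons rmorphM unitmx_mul ur andbT rmorphB /= horner_mx_X horner_mx_C.
  rewrite -opprB -scaleN1r unitmxZ ?unitrN1 //.
  by rewrite eigenvalue_unitmx negbK in Ba.
by rewrite -[X](mulKmx uB) -XE Cayley_Hamilton !mulmx0.
Qed.

(** * Values of rational functions and rational matrices at a complex point *)

Section Values.
Variable K : realType.
Implicit Types (f g : ratfun K) (z v w : K[i]).

Lemma ceval_neq0 (q : {poly K}) z : ceval q z != 0 -> tofrac q != 0.
Proof.
by rewrite tofrac_eq0; apply: contraNneq => ->; rewrite /ceval rmorph0 horner0.
Qed.

Lemma has_value_poly (p : {poly K}) z : has_value (tofrac p) z (ceval p z).
Proof.
exists p, 1; split; first by rewrite tofrac1 divr1.
  by rewrite /ceval rmorph1 hornerC oner_neq0.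
by rewrite /ceval rmorph1 hornerC divr1.
Qed.

Lemma has_value_const (c : K) z : has_value (rconst c) z (real_complex K c).
Proof. by have := has_value_poly c%:P z; rewrite /ceval map_polyC hornerC. Qed.

Lemma has_value_var z : has_value (rvar K) z z.
Proof. by have := has_value_poly 'X z; rewrite /ceval map_polyX hornerX. Qed.

Lemma has_valueD f g z v w :
  has_value f z v -> has_value g z w -> has_value (f + g) z (v + w).
Proof.
move=> [p [q [-> q0 ->]]] [p' [q' [-> q'0 ->]]].
exists (p * q' + p' * q), (q * q'); split.
- rewrite tofracD !tofracM; apply: addf_div; first exact: ceval_neq0 q0.
  exact: ceval_neq0 q'0.
- by rewrite /ceval rmorphM hornerM mulf_neq0.
- by rewrite addf_div // /ceval rmorphD !rmorphM hornerD !hornerM.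
Qed.

Lemma has_valueM f g z v w :
  has_value f z v -> has_value g z w -> has_value (f * g) z (v * w).
Proof.
move=> [p [q [-> q0 ->]]] [p' [q' [-> q'0 ->]]].
exists (p * p'), (q * q'); split.
- by rewrite mulf_div !tofracM.
- by rewrite /ceval rmorphM hornerM mulf_neq0.
- by rewrite mulf_div /ceval !rmorphM !hornerM.
Qed.

Lemma has_value0 z : has_value 0 z 0.
Proof. by have := has_value_const 0 z; rewrite /rconst polyC0 tofrac0 rmorph0. Qed.

(** These signs occur in the Leibniz expansion and in the cofactors; exponent 1 yields negation. *)
Lemma has_value_sign (b : nat) z : has_value ((-1) ^+ b) z ((-1) ^+ b).
Proof.
have := has_value_const ((-1) ^+ b) z.
rewrite /rconst rmorphXn rmorphN rmorph1 tofracXn tofracN tofrac1.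
by rewrite rmorphXn rmorphN rmorph1.
Qed.

Lemma has_valueN f z v : has_value f z v -> has_value (- f) z (- v).
Proof.
by move=> h; have := has_valueM (has_value_sign 1 z) h; rewrite !expr1 !mulN1r.
Qed.

Lemma has_valueV f z v : v != 0 -> has_value f z v -> has_value f^-1 z v^-1.
Proof.
move=> v0 [p [q [-> q0 vE]]]; exists q, p; split; first by rewrite invf_div.
  by apply: contraNneq v0 => p0; rewrite vE p0 mul0r.
by rewrite vE invf_div.
Qed.

Lemma has_value_flip f z v : has_value f (- z) v -> has_value (rflip f) z v.
Proof.
have cE (p : {poly K}) : ceval (p \Po - 'X) z = ceval p (- z).
  by rewrite /ceval map_comp_poly horner_comp rmorphN /= map_polyX hornerN hornerX.
move=> [p [q [-> q0 ->]]]; exists (p \Po - 'X), (q \Po - 'X).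
by rewrite rflip_frac ?cE // -tofrac_eq0 (ceval_neq0 q0).
Qed.

(** Rectangular counterpart of [mx_has_value], for the factors of a transfer function. *)
Definition mxvalue m n (F : 'M[ratfun K]_(m, n)) z (M : 'M[K[i]]_(m, n)) :=
  forall i j, has_value (F i j) z (M i j).

Lemma has_value_sum (I : Type) (r : seq I) (P : pred I) (F : I -> ratfun K)
    (G : I -> K[i]) z :
  (forall i, has_value (F i) z (G i)) ->
  has_value (\sum_(i <- r | P i) F i) z (\sum_(i <- r | P i) G i).
Proof.
move=> FG; elim/big_ind2: _ => // [|*]; last exact: has_valueD.
exact: has_value0.
Qed.

Lemma has_value_prod (I : Type) (r : seq I) (P : pred I) (F : I -> ratfun K)
    (G : I -> K[i]) z :
  (forall i, has_value (F i) z (G i)) ->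
  has_value (\prod_(i <- r | P i) F i) z (\prod_(i <- r | P i) G i).
Proof.
move=> FG; elim/big_ind2: _ => // [|*]; last exact: has_valueM.
by have := has_value_const 1 z; rewrite /rconst polyC1 tofrac1 rmorph1.
Qed.

Lemma mxvalueM m n p (F : 'M_(m, n)) (G : 'M_(n, p)) z M N :
  mxvalue F z M -> mxvalue G z N -> mxvalue (F *m G) z (M *m N).
Proof.
by move=> FM GN i j; rewrite !mxE; apply: has_value_sum => k; apply: has_valueM.
Qed.

Lemma mxvalueD m n (F G : 'M_(m, n)) z M N :
  mxvalue F z M -> mxvalue G z N -> mxvalue (F + G) z (M + N).
Proof. by move=> FM GN i j; rewrite !mxE; apply: has_valueD. Qed.

Lemma mxvalue_const m n (M : 'M[K]_(m, n)) z :
  mxvalue (map_mx (@rconst K) M) z (map_mx (real_complex K) M).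
Proof. by move=> i j; rewrite !mxE; apply: has_value_const. Qed.

Lemma mxvalue_flip m n (F : 'M_(m, n)) z M :
  mxvalue F (- z) M -> mxvalue (map_mx (@rflip K) F)^T z M^T.
Proof. by move=> FM i j; rewrite !mxE; apply: has_value_flip. Qed.

Lemma has_value_det n (F : 'M_n) z M :
  mxvalue F z M -> has_value (\det F) z (\det M).
Proof.
move=> FM; apply: has_value_sum => s; apply: has_valueM; first exact: has_value_sign.
exact: has_value_prod.
Qed.

(** Cramer's rule: the inverse consists of cofactors divided by a determinant whose value at [z] is
    nonzero. *)
Lemma mxvalueV n (F : 'M_n) z M :
  M \in unitmx -> mxvalue F z M -> mxvalue (invmx F) z (invmx M).
Proof.
move=> uM FM; have hd := has_value_det FM.
have M0 : \det M != 0 by rewrite -unitfE -unitmxE.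
(* Values are unique, so a zero formal determinant would have value 0. Hence [invmx F] is a true
   inverse and not its default [F]. *)
have F0 : \det F != 0.
  apply: contraNneq M0 => F0; rewrite F0 in hd.
  by rewrite (has_value_inj hd (has_value0 z)).
rewrite /invmx uM unitmxE unitfE F0 => i j; rewrite !mxE.
apply: has_valueM; first exact: has_valueV.
apply: has_valueM; first exact: has_value_sign.
by apply: has_value_det => k l; rewrite !mxE; apply: FM.
Qed.

Definition ctransfer n m (A : 'M[K]_n) (B : 'M[K]_(n, m)) (C : 'M[K]_(m, n))
    (D : 'M[K]_m) (z : K[i]) : 'M[K[i]]_m :=
  map_mx (real_complex K) C *m invmx (z%:M - map_mx (real_complex K) A)
    *m map_mx (real_complex K) B + map_mx (real_complex K) D.

Lemma transfer_value n m (A : 'M[K]_n) (B : 'M[K]_(n, m)) C D z :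
  ~~ eigenvalue (map_mx (real_complex K) A) z ->
  mxvalue (transfer A B C D) z (ctransfer A B C D z).
Proof.
rewrite eigenvalue_unitmx negbK => uA.
apply: mxvalueD (mxvalue_const _ _); apply: mxvalueM (mxvalue_const _ _).
apply: mxvalueM; first exact: mxvalue_const.
apply: mxvalueV => // i j; rewrite !mxE; apply: has_valueD; last first.
  by apply: has_valueN; apply: has_value_const.
case: (i == j); rewrite ?mulr1n ?mulr0n; first exact: has_value_var.
exact: has_value0.
Qed.

End Values.

(** * Lyapunov equation and spectral factorization on the imaginary axis *)

Section Adjoint.
Local Open Scope sesquilinear_scope.
Variable F : numClosedFieldType.

Lemma adjmxM m n p (M : 'M[F]_(m, n)) (N : 'M[F]_(n, p)) :
  (M *m N)^t* = N^t* *m M^t*.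
Proof. by rewrite trmx_mul map_mxM. Qed.

Lemma adjmxD m n (M N : 'M[F]_(m, n)) : (M + N)^t* = M^t* + N^t*.
Proof. by rewrite linearD /= map_mxD. Qed.

Lemma adjmxB m n (M N : 'M[F]_(m, n)) : (M - N)^t* = M^t* - N^t*.
Proof. by rewrite linearB /= map_mxB. Qed.

Lemma adjmxK m n (M : 'M[F]_(m, n)) : (M^t*)^t* = M.
Proof. by apply/matrixP=> i j; rewrite !mxE conjCK. Qed.

Lemma adjmx_scalar n (z : F) : (z%:M : 'M_n)^t* = (Num.conj z)%:M.
Proof. by rewrite tr_scalar_mx map_scalar_mx. Qed.

Lemma adjmxZ m n (z : F) (M : 'M[F]_(m, n)) : (z *: M)^t* = Num.conj z *: M^t*.
Proof. by rewrite linearZ /= map_mxZ. Qed.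

Variables (n m : nat) (A X : 'M[F]_n) (B : 'M[F]_(n, m)) (C W : 'M[F]_(m, n)).
Variable S : 'M[F]_m.
Hypothesis S_herm : S^t* = S.
Hypothesis S_pos : forall y : 'cV_m, y != 0 -> 0 < (y^t* *m S *m y) 0 0.
Hypothesis X_herm : X^t* = X.
Hypothesis lyapunov : A^t* *m X + X *m A = - (W^t* *m S *m W).
Hypothesis outputE : C = B^t* *m X - S *m W.

(** Sandwich the Lyapunov equation between [v^t*] and [v]. *)
Lemma lyapunov_eigenvector z (v : 'cV_n) : A *m v = z *: v ->
  (Num.conj z + z) * (v^t* *m X *m v) 0 0 =
  - ((W *m v)^t* *m S *m (W *m v)) 0 0.
Proof.
move=> Av; transitivity ((v^t* *m - (W^t* *m S *m W) *m v) 0 0); last first.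
  by rewrite mulmxN mulNmx [LHS]mxE adjmxM !mulmxA.
rewrite -lyapunov mulmxDr mulmxDl [RHS]mxE !mulmxA -adjmxM Av adjmxZ -!scalemxAl.
rewrite -[v^t* *m X *m A *m v]mulmxA Av -scalemxAr mulrDl.
by congr (_ + _); rewrite [RHS]mxE.
Qed.

(** Here [Num.conj z + z] vanishes, so the form [S] vanishes at [W *m v]; by definiteness
    [W *m v = 0], and [A] and [A + B *m W] agree on [v]. *)
Lemma imaginary_eigenvector z (v : 'cV_n) :
  Num.conj z = - z -> A *m v = z *: v -> (A + B *m W) *m v = z *: v.
Proof.
move=> zE Av; suff Wv : W *m v = 0 by rewrite mulmxDl -mulmxA Wv mulmx0 addr0.
apply/eqP; apply: contraT => /S_pos; have := lyapunov_eigenvector Av.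
by rewrite zE addNr mul0r => /eqP; rewrite eq_sym oppr_eq0 => /eqP->; rewrite ltxx.
Qed.

Variable z : F.
Hypothesis z_imag : Num.conj z = - z.
Hypothesis zR : ~~ eigenvalue (A + B *m W) z.

Lemma imaginary_regular : ~~ eigenvalue A z.
Proof.
apply: contraNN zR => /col_eigenvalueP[v v0 Av]; apply/col_eigenvalueP.
by exists v => //; apply: imaginary_eigenvector.
Qed.

(** [N] is the resolvent at [z], [G] the spectral factor and [P] the strictly proper part of the
    transfer function. *)
Let N := invmx (z%:M - A).
Let G := 1%:M - W *m N *m B.
Let P := C *m N *m B.

Lemma resolventK : (z%:M - A) *m N = 1%:M.
Proof.
by apply: mulmxV; have := imaginary_regular; rewrite eigenvalue_unitmx negbK.
Qed.

(** Multiplying the Lyapunov equation by [N^t*] and [N] trades the term of [G^t* *m S *m G]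
    quadratic in the resolvent for linear ones, which the output equation matches with
    [P^t* + P]. *)
Lemma spectral_factorization : P^t* + P + S = G^t* *m S *m G.
Proof.
have XN : X *m N + N^t* *m X = N^t* *m W^t* *m S *m W *m N.
  have NK : N^t* *m (z%:M - A)^t* = 1%:M.
    by rewrite -adjmxM resolventK adjmx_scalar rmorph1.
  (* As [Num.conj z = - z], the two multiples of [X] by [z] cancel and only the Lyapunov expression
     is left. *)
  have -> : N^t* *m W^t* *m S *m W *m N =
      N^t* *m ((z%:M - A)^t* *m X + X *m (z%:M - A)) *m N.
    rewrite -!mulmxA; congr (_ *m _); rewrite !mulmxA; congr (_ *m _).
    rewrite adjmxB adjmx_scalar z_imag mulmxBl mulmxBr mul_scalar_mx mul_mx_scalar.
    by rewrite scaleNr addrACA addNr add0r -opprD lyapunov opprK.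
  rewrite mulmxDr mulmxDl mulmxA NK mul1mx -!mulmxA resolventK mulmx1.
  by [].
rewrite /G adjmxB adjmx_scalar rmorph1 mulmxBl mul1mx mulmxBr mulmx1 mulmxBl.
rewrite /P outputE.
have -> : (B^t* *m X - S *m W) *m N *m B =
    B^t* *m (X *m N) *m B - S *m (W *m N *m B).
  by rewrite !mulmxBl !mulmxA.
rewrite adjmxB !adjmxM S_herm X_herm adjmxK.
have -> : B^t* *m (N^t* *m W^t*) *m S *m (W *m N *m B) =
    B^t* *m (X *m N + N^t* *m X) *m B.
  by rewrite XN !mulmxA.
rewrite mulmxDr mulmxDl !mulmxA.
set a := _ *m X *m N *m _; set b := _ *m X *m B; set c := S *m W *m N *m B.
set d := B^t* *m _ *m _ *m S.
by rewrite opprB addrC addrACA -[RHS]addrA [- d + (_ + _)]addrCA [b + a]addrC.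
Qed.

(** If [G *m x = 0], then [y = N *m B *m x] satisfies [x = W *m y], so [y] is nonzero, and [(A + B
    *m W) *m y = A *m y + B *m x = z *: y]. *)
Lemma spectral_factor_inj (x : 'cV_m) : x != 0 -> G *m x != 0.
Proof.
move=> x0; apply: contraNneq zR => Gx; apply/col_eigenvalueP.
have xE : x = W *m (N *m B *m x).
  by apply/eqP; rewrite -subr_eq0 -{1}[x]mul1mx !mulmxA -mulmxBl Gx.
exists (N *m B *m x).
  by apply: contraNneq x0 => y0; rewrite xE y0 mulmx0.
apply/eqP; rewrite mulmxDl -[B *m W *m _]mulmxA -xE -mul_scalar_mx eq_sym -subr_eq0.
by rewrite opprD addrA -mulmxBl !mulmxA resolventK mul1mx subrr.
Qed.

Lemma popov_posdef (x : 'cV_m) : x != 0 ->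
  0 < (x^t* *m (P^t* + P + S) *m x) 0 0.
Proof.
move=> /spectral_factor_inj/S_pos; rewrite spectral_factorization.
by rewrite adjmxM !mulmxA.
Qed.

End Adjoint.

(** * Real matrices viewed over the complex numbers *)

Section RealMatrices.
Local Open Scope sesquilinear_scope.
Variable K : realType.
Local Notation rc := (real_complex K).
Local Notation "M %:cM" := (map_mx rc M) (at level 2, format "M %:cM").

Lemma adjmx_real m n (M : 'M[K]_(m, n)) : M%:cM^t* = M^T%:cM.
Proof. by apply/matrixP=> i j; rewrite !mxE conj_Creal // complex_real. Qed.

Lemma cmx_ReIm m n (M : 'M[K[i]]_(m, n)) :
  M = (map_mx (@complex.Re K) M)%:cM + 'i%C *: (map_mx (@complex.Im K) M)%:cM.
Proof. by apply/matrixP=> i j; rewrite !mxE -complexE. Qed.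

(** For [x = a + i b] the cross terms cancel by symmetry, leaving the sum of the real forms at [a]
    and [b], which are not both zero. *)
Lemma sym_posdef_complex m (S : 'M[K]_m) (x : 'cV[K[i]]_m) :
  sym_posdef S -> x != 0 -> 0 < (x^t* *m S%:cM *m x) 0 0.
Proof.
move=> [Ssym Spos] x0.
have ST : S^T = S.
  by move/is_hermitianmxP: Ssym; rewrite expr0 scale1r => {2}->; rewrite map_mx_id.
set a := map_mx (@complex.Re K) x; set b := map_mx (@complex.Im K) x.
(* A 1 by 1 matrix equals its transpose. *)
have cross : b^T *m S *m a = a^T *m S *m b.
  rewrite -[LHS]trmxK; have -> : (b^T *m S *m a)^T = b^T *m S *m a.
    by apply/matrixP => i j; rewrite !ord1 mxE.
  by rewrite !trmx_mul trmxK ST mulmxA.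
have xE : x^t* *m S%:cM *m x = (a^T *m S *m a + b^T *m S *m b)%:cM.
  rewrite [x]cmx_ReIm -/a -/b adjmxD adjmxZ !adjmx_real complexiE conjCi.
  rewrite !mulmxDl !mulmxDr.
  rewrite -!scalemxAl -!scalemxAr -!map_mxM scalerA cross.
  by rewrite scaleNr addrA addrK mulNr -expr2 sqrCi opprK scale1r map_mxD.
have Sge0 (y : 'cV[K]_m) : 0 <= (y^T *m S *m y) 0 0.
  have [->|/Spos/ltW//] := eqVneq y 0.
  by rewrite mulmx0 mxE.
rewrite xE mxE [X in 0 < rc X]mxE -[0]/(rc 0) ltcR.
have [a0|a0] := eqVneq a 0; last by rewrite ltr_wpDr ?Spos.
rewrite ltr_wpDl // Spos //; apply: contraNneq x0 => b0.
by rewrite [x]cmx_ReIm -/a -/b a0 b0 !map_mx0 scaler0 addr0.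
Qed.

(** On the imaginary axis this identifies the value at [- z] with the conjugate of the value at
    [z]. *)
Lemma conj_ctransfer n m (A : 'M[K]_n) (B : 'M[K]_(n, m)) C D (z : K[i]) :
  map_mx Num.conj (ctransfer A B C D z) = ctransfer A B C D (Num.conj z).
Proof.
have conj_real p q (M : 'M[K]_(p, q)) : map_mx Num.conj M%:cM = M%:cM.
  by apply/matrixP=> i j; rewrite !mxE conj_Creal // complex_real.
by rewrite map_mxD !map_mxM map_invmx map_mxB map_scalar_mx !conj_real.
Qed.

(** * Strict positive realness and stability from the real Lyapunov and output equations *)

Section Popov.
Variables (n m : nat) (A X : 'M[K]_n) (B : 'M[K]_(n, m)) (C W : 'M[K]_(m, n)).
Variable D : 'M[K]_m.
Let S := D + D^T.
Hypothesis S_pos : sym_posdef S.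
Hypothesis X_sym : X^T = X.
Hypothesis lyapunov : A^T *m X + X *m A = - (W^T *m S *m W).
Hypothesis outputE : C = B^T *m X - S *m W.
Hypothesis R_antistable : spectrum_in (A + B *m W) (fun z => 0 < complex.Re z).

Let S_herm : S%:cM^t* = S%:cM.
Proof. by rewrite adjmx_real linearD /= trmxK addrC. Qed.

Let X_herm : X%:cM^t* = X%:cM.
Proof. by rewrite adjmx_real X_sym. Qed.

Let S_posC (y : 'cV_m) : y != 0 -> 0 < (y^t* *m S%:cM *m y) 0 0.
Proof. exact: sym_posdef_complex. Qed.

Let lyapunovC :
  A%:cM^t* *m X%:cM + X%:cM *m A%:cM = - (W%:cM^t* *m S%:cM *m W%:cM).
Proof. by rewrite !adjmx_real -!map_mxM -map_mxD lyapunov map_mxN. Qed.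

Let outputC : C%:cM = B%:cM^t* *m X%:cM - S%:cM *m W%:cM.
Proof. by rewrite !adjmx_real -!map_mxM -map_mxB outputE. Qed.

Let R_noneig (z : K[i]) : complex.Re z <= 0 ->
  ~~ eigenvalue (A%:cM + B%:cM *m W%:cM) z.
Proof.
move=> z0; apply/negP; rewrite -map_mxM -map_mxD => /R_antistable.
by rewrite ltNge z0.
Qed.

Let imaginary_noneig (z : K[i]) : complex.Re z = 0 -> ~~ eigenvalue A%:cM z.
Proof.
move=> z0; apply: (@imaginary_regular _ _ _ _ _ B%:cM _ _ S_posC lyapunovC).
  2: by rewrite R_noneig ?z0.
by case: z z0 => a b /= ->; apply/eqP; rewrite eq_complex /= oppr0 !eqxx.
Qed.

Lemma popov_strictly_positive_real : strictly_positive_real (transfer A B C D).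
Proof.
move=> w; set z := Complex 0 w; set P := ctransfer A B C D z.
have zE : Num.conj z = - z by apply/eqP; rewrite eq_complex /= oppr0 !eqxx.
have zR := @R_noneig z (lexx 0); have zA := @imaginary_noneig z erefl.
(* Since [- z] is the conjugate of [z] and the coefficients are real, the flipped and transposed
   summand of [Phi] takes the value [P^t*]. *)
exists (P^t* + P).
  apply: mxvalueD; last exact: transfer_value.
  rewrite -[P^t*]map_trmx; apply: mxvalue_flip; rewrite -zE conj_ctransfer.
  by apply: transfer_value; apply: imaginary_noneig.
split.
  by apply/is_hermitianmxP; rewrite expr0 scale1r [RHS]adjmxD adjmxK addrC.
move=> x x0.
set Q := C%:cM *m invmx (z%:M - A%:cM) *m B%:cM.
(* The constant terms [D^T] and [D] add up to [S], leaving the strictly proper part [Q]. *)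
have -> : P^t* + P = Q^t* + Q + S%:cM.
  by rewrite /P /ctransfer -/Q adjmxD addrACA adjmx_real -map_mxD [D^T + D]addrC.
have pd := popov_posdef S_herm S_posC X_herm lyapunovC outputC zE zR x0.
exact: pd.
Qed.

(** An eigenvector with [Re z > 0] would make the left side of [lyapunov_eigenvector] positive and
    the right side nonpositive; the case [Re z = 0] is excluded by the spectrum of [A + B *m W]. *)
Lemma popov_asymptotically_stable :
  (forall x : 'cV_n, x != 0 -> 0 < (x^T *m X *m x) 0 0) ->
  asymptotically_stable A.
Proof.
move=> X_pos z zA.
have [//|z_gt0|z0] := ltgtP (complex.Re z) 0; last first.
  by have := imaginary_noneig z0; rewrite zA.
have /col_eigenvalueP[v v0 Av] := zA.
have X_pd : sym_posdef X.
  by split=> //; apply/is_hermitianmxP; rewrite expr0 scale1r map_mx_id.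
have Xv := sym_posdef_complex X_pd v0.
have := lyapunov_eigenvector lyapunovC Av.
have zz : 0 < Num.conj z + z.
  rewrite ltcE; case: (z) z_gt0 => a b /= a0.
  by rewrite addNr eqxx addr_gt0.
move/esym/eqP; rewrite eqr_oppLR => /eqP WW.
have : 0 <= ((W%:cM *m v)^t* *m S%:cM *m (W%:cM *m v)) 0 0.
  have [->|/S_posC/ltW//] := eqVneq (W%:cM *m v) 0.
  by rewrite mulmx0 mxE.
by rewrite WW oppr_ge0 lt_geF ?mulr_gt0.
Qed.

End Popov.
End RealMatrices.

(** * The pencil identity and uniqueness for the Lyapunov equation *)

Lemma pencil_const (K : realType) n m p (A : 'M[K]_n) (B : 'M[K]_(n, m))
    (C : 'M[K]_(m, n)) (D : 'M[K]_m) (U V : 'M[K]_(n, p)) (W : 'M[K]_(m, p))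
    (R : 'M[K]_p) :
  pencil A B C D *m polymx (col_mx (col_mx U V) W) =
    polymx (col_mx (col_mx V (- U)) 0) *m (polymx R - ('X)%:M) ->
  [/\ A *m V + B *m W = V *m R, A^T *m U + C^T *m W = - (U *m R) &
      B^T *m U + C *m V + (D + D^T) *m W = 0].
Proof.
have evC k l (M : 'M[K]_(k, l)) : map_mx (horner_eval 0) (polymx M) = M.
  by apply/matrixP=> i j; rewrite !mxE /horner_eval hornerC.
have evX k : map_mx (horner_eval 0) ('X%:M : 'M[{poly K}]_k) = 0.
  by rewrite map_scalar_mx /= /horner_eval hornerX raddf0.
(* Evaluation at 0 loses nothing: the coefficients of the indeterminate on the two sides agree for
   any [U], [V], [W]. *)
move=> /(congr1 (map_mx (horner_eval 0))).
rewrite !map_mxM map_mxB !evC evX subr0 /pencil !map_col_mx !map_row_mx.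
rewrite !map_mxB !map_mxD !map_mx0 !evC evX subr0 addr0.
rewrite !mul_col_mx !mul_row_col mulNmx !mul0mx add0r addr0.
by move=> /eq_col_mx[/eq_col_mx[-> ->] E]; rewrite [D + _]addrC E.
Qed.
(** The spectra of [R] and [- R^T] lie in opposite open half planes, so [sylvester_inj] applies. *)
Lemma lyapunov_inj (K : realType) n (R E : 'M[K]_n) :
  spectrum_in R (fun z => 0 < complex.Re z) -> R^T *m E + E *m R = 0 -> E = 0.
Proof.
move=> hR lyap; apply/eqP; rewrite -(map_mx_eq0 (real_complex K)); apply/eqP.
set Rc := map_mx (real_complex K) R.
apply: (@sylvester_inj _ _ _ Rc (- Rc^T)).
  move=> a /hR a_gt0; apply/negP => /col_eigenvalueP[v v0 Ev].
  (* [eigenvalue] refers to row vectors, so the transpose of an eigenvector of [- Rc^T] serves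
     directly. *)
  have /hR : eigenvalue Rc (- a).
    apply/eigenvalueP; exists v^T; last by rewrite trmx_eq0.
    by apply: trmx_inj; rewrite trmx_mul trmxK linearZ /= trmxK scaleNr -Ev
      mulNmx opprK.
  by case: a a_gt0 {Ev} => a b /= a_gt0; rewrite oppr_gt0 lt_gtF.
rewrite mulNmx map_trmx -!map_mxM -map_mxN; congr map_mx.
by apply/eqP; rewrite -addr_eq0 addrC lyap.
Qed.

Theorem theorem4 (K : realType) (n m nh : nat)
  (A : 'M[K]_n) (B : 'M[K]_(n, m)) (C : 'M[K]_(m, n)) (D : 'M[K]_m)
  (Z : 'M[ratfun K]_m)
  (U V : 'M[K]_(n, nh)) (W : 'M[K]_(m, nh)) (R : 'M[K]_nh)
  (hZ : minimal_realization Z A B C D)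
  (hD : sym_posdef (D + D^T))
  (hrank : \rank (col_mx (col_mx U V) W) = nh)
  (hpencil :
     pencil A B C D *m polymx (col_mx (col_mx U V) W) =
     polymx (col_mx (col_mx V (- U)) 0) *m (polymx R - ('X)%:M))
  (hR : spectrum_in R (fun z => 0 < complex.Re z)) :
  let Xh := - (U^T *m V) in
  let Ah := invmx (U^T *m V) *m U^T *m A *m V in
  let Bh := invmx (U^T *m V) *m U^T *m B in
  let Ch := C *m V in
  let Dh := D in
  Xh \is symmetricmx /\
  (Xh \in unitmx ->
     strictly_positive_real (transfer Ah Bh Ch Dh) /\
     (sym_posdef Xh -> strictly_passive Ah Bh Ch Dh)).
Proof.
move=> Xh Ah Bh Ch Dh.
have [E1 E2 E3] := pencil_const hpencil.
set S := D + D^T in hD E3 *.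
have S_sym : S^T = S by rewrite linearD /= trmxK addrC.
set Y := U^T *m V in Xh Ah Bh *; have YE : Y = U^T *m V by []; clearbody Y.
(* [BW] and [UA] are the transposed third and second block rows of the pencil identity. *)
have BW : U^T *m B = - (V^T *m C^T) - W^T *m S.
  apply: trmx_inj; rewrite linearB linearN /= !trmx_mul !trmxK S_sym.
  by apply/eqP; rewrite -opprD -addr_eq0 addrA E3.
have UA : U^T *m A = - (R^T *m U^T) - W^T *m C.
  apply: trmx_inj; rewrite linearB linearN /= !trmx_mul !trmxK.
  by rewrite -E2 addrK.
set q := W^T *m C *m V; set w := W^T *m S *m W.
have qT : q^T = V^T *m C^T *m W by rewrite !trmx_mul trmxK mulmxA.
have wT : w^T = w by rewrite !trmx_mul trmxK S_sym mulmxA.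
have UAV : U^T *m A *m V = - (R^T *m Y) - q by rewrite UA YE mulmxBl mulNmx mulmxA.
have UBW : U^T *m B *m W = - q^T - w by rewrite BW mulmxBl mulNmx qT.
have YR : Y *m R = U^T *m A *m V + U^T *m B *m W.
  by rewrite YE -!mulmxA -mulmxDr E1.
(* The right side is symmetric, so subtracting the transposed equation leaves a homogeneous Lyapunov
   equation for [Y - Y^T]. *)
have lyapY : R^T *m Y + Y *m R = - (q + q^T + w).
  by rewrite YR UAV UBW -addrA addNKr !opprD addrA.
have Y_sym : Y^T = Y.
  apply/eqP; rewrite eq_sym -subr_eq0; apply/eqP/(lyapunov_inj hR).
  have lyapT : R^T *m Y^T + Y^T *m R = - (q + q^T + w).
    have := congr1 trmx lyapY; rewrite linearD linearN !linearD /= wT [q^T^T]trmxK.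
    rewrite [(R^T *m Y)^T]trmx_mul [(Y *m R)^T]trmx_mul trmxK.
    by rewrite [- q^T - q]addrC [R^T *m Y^T + _]addrC.
  rewrite mulmxBr mulmxBl addrACA lyapY.
  by apply/eqP; rewrite -opprD subr_eq0 lyapT eqxx.
have X_sym : Xh^T = Xh by rewrite /Xh linearN /= Y_sym.
split; first by apply/is_hermitianmxP; rewrite expr0 scale1r map_mx_id.
have -> : (Xh \in unitmx) = (Y \in unitmx)
  by rewrite /Xh -scaleN1r unitmxZ ?unitrN1.
move=> uY.
have YB : Y *m Bh = U^T *m B by rewrite /Bh -mulmxA mulKVmx.
have YA : Y *m Ah = U^T *m A *m V by rewrite /Ah -!mulmxA mulKVmx.
(* This is the first block row multiplied by [U^T], with [Y] cancelled. *)
have RE : Ah + Bh *m W = R.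
  by rewrite -[RHS](mulKmx uY) YR -YA -YB -mulmxA -mulmxDr mulKmx.
have outE : Ch = Bh^T *m Xh - S *m W.
  rewrite mulmxN -{1}Y_sym -trmx_mul YB trmx_mul trmxK -opprD.
  by apply/eqP; rewrite -addr_eq0 addrCA addrA E3.
have lyap : Ah^T *m Xh + Xh *m Ah = - (W^T *m S *m W).
  rewrite mulmxN mulNmx -{1}Y_sym -trmx_mul YA -opprD -/w; congr (- _).
  (* The two copies of [U^T *m A *m V] are expanded differently, one through [YR] and the transposed
     one through [UAV]; everything but [w] then cancels. *)
  rewrite {2}[U^T *m A *m V](_ : _ = Y *m R + q^T + w); last first.
    by rewrite -addrA YR UBW -opprD subrK.
  rewrite UAV linearB linearN /= [(R^T *m Y)^T]trmx_mul trmxK Y_sym.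
  by rewrite -opprD addrA addNr add0r.
have R_anti : spectrum_in (Ah + Bh *m W) (fun z => 0 < complex.Re z) by rewrite RE.
have spr := popov_strictly_positive_real hD X_sym lyap outE R_anti.
split; first exact: spr.
move=> X_pd; split; first exact: spr.
exact: popov_asymptotically_stable hD X_sym lyap R_anti X_pd.2.
Qed.
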